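(* Let $\nu$ be a proper $k$-coloring of $G$ that uses all $k$ colors, and let $g_1,\ldots,g_n$ be the $\nu$-basis associated to $\nu$. Then the following statements are equivalent: (1) The graph $G$ is uniquely $k$-colorable. (2) The polynomials $g_1,\ldots,g_n$ generate the ideal $I_{G,k}$. (3) The polynomials $g_1,\ldots,g_n$ belong to the ideal $I_{G,k}$. (4) The graph polynomial $f_G$ belongs to the ideal $I_{n,k}:\langle g_1,\ldots,g_n\rangle$. (5) $\dim_{\Bbbk}R/I_{G,k}=k!$.
   Context: $G$ is a simple undirected graph with vertex set $\{1,\ldots,n\}$ and edge set $E$. $k$ is a fixed positive integer with $k<n$. $C_k$ is a fixed set of $k$ colors; a $k$-coloring of $G$ is a map $\nu:\{1,\ldots,n\}\to C_k$, and it is proper if adjacent vertices receive different colors. $G$ is uniquely $k$-colorable if there is a unique proper $k$-coloring of $G$ up to permutation of the colors in $C_k$ (in particular one exists). $\Bbbk$ is an algebraically closed field of characteristic not dividing $k$, and $R=\Bbbk[x_1,\ldots,x_n]$. The graph polynomial is $f_G=\prod_{\{i,j\}\in E,\ i<j}(x_i-x_j)$. The ideal $I_{n,k}$ is $\langle x_i^k-1: 1\le i\le n\rangle$, and $$I_{G,k}=I_{n,k}+\langle x_i^{k-1}+x_i^{k-2}x_j+\cdots+x_ix_j^{k-2}+x_j^{k-1}:\{i,j\}\in E\rangle.$$ For ideals $I,J$ of $R$, $I:J=\{h\in R: hJ\subseteq I\}$. For $U\subseteq\{1,\ldots,n\}$ and $d\ge 0$, $h_U^d$ denotes the sum of all monomials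 of degree $d$ in the indeterminates $\{x_i: i\in U\}$, with $h_U^0=1$. $\nu$-basis: given a proper $k$-coloring $\nu$ of $G$, let $l\le k$ be the number of distinct colors in the image of $\nu$ (so $l=k$ when $\nu$ uses all $k$ colors). The color class $cl(i)$ of a vertex $i$ is the set of vertices with the same color as $i$. Let $m_1<m_2<\cdots<m_l=n$ be the maximums (largest vertices) of the $l$ color classes. For each vertex $i$ define $$g_i=\begin{cases}x_i^k-1 & \text{if } i=m_l,\\ h^{k-l+j}_{\{m_j,\ldots,m_l\}} & \text{if } i=m_j \text{ for some } j\ne l,\\ x_i-x_{\max cl(i)} & \text{otherwise.}\end{cases}$$ The set $\{g_1,\ldots,g_n\}$ is the $\nu$-basis. *)

(* Defs.v *)
From HB Require Import structures.
From mathcomp Require Import all_boot all_order all_fingroup all_algebra.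
From mathcomp Require Import mpoly.

Set Implicit Arguments.
Unset Strict Implicit.
Unset Printing Implicit Defensive.

Import GRing.Theory.
Local Open Scope ring_scope.

(* Ideals are Prop-valued predicates: membership need not be decidable and
   the unit ideal is allowed, unlike MathComp's [idealr]. *)
Section Ideals.
Variable A : comNzRingType.
Implicit Types I J : A -> Prop.

Definition ideal_gen (T : finType) (P : pred T) (F : T -> A) : A -> Prop :=
  fun p => exists c : T -> A, p = \sum_(t | P t) c t * F t.

Definition ideal_add I J : A -> Prop :=
  fun p => exists a b, [/\ I a, J b & p = a + b].

Definition ideal_colon I J : A -> Prop :=
  fun h => forall p, J p -> I (h * p).
End Ideals.

(* dim_K (A / I) = d: the classes modulo I of some family b of d elements
   span A / I and are linearly independent over K. *)
Definition quotient_dim (K : fieldType) (A : comAlgType K) (I : A -> Prop)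
    (d : nat) : Prop :=
  exists b : 'I_d -> A,
    (forall p, exists c : 'I_d -> K, I (p - \sum_i c i *: b i)) /\
    (forall c : 'I_d -> K, I (\sum_i c i *: b i) -> forall i, c i = 0).

(* The vertices 1, ..., n of the graph are the elements 0, ..., n - 1 of 'I_n. *)
Section Colorings.
Variables (n : nat) (C : finType).
Implicit Types (e : rel 'I_n) (nu mu : {ffun 'I_n -> C}).

Definition proper_coloring e nu : Prop := forall i j, e i j -> nu i != nu j.

Definition uniquely_colorable e : Prop :=
  (exists nu, proper_coloring e nu) /\
  (forall nu mu, proper_coloring e nu -> proper_coloring e mu ->
     exists s : {perm C}, forall i, mu i = s (nu i)).

Definition color_class nu (i : 'I_n) : {set 'I_n} := [set j | nu j == nu i].

Definition max_class nu (i : 'I_n) : 'I_n :=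
  [arg max_(j > i in color_class nu i) (j : nat)]%N.

(* The sequence m_1 < ... < m_l; [enum 'I_n] is increasing. *)
Definition class_maxs nu : seq 'I_n :=
  [seq i <- enum 'I_n | i == max_class nu i].

Definition num_colors nu : nat := #|codom nu|.
End Colorings.

Section GraphIdeals.
Variables (K : fieldType) (n : nat).

Definition graph_poly (e : rel 'I_n) : {mpoly K[n]} :=
  \prod_(i < n) \prod_(j < n | e i j && (i < j)%N) ('X_i - 'X_j).

Definition ideal_nk (k : nat) : {mpoly K[n]} -> Prop :=
  ideal_gen xpredT (fun i : 'I_n => 'X_i ^+ k - 1).

(* Each edge {i, j} occurs as (i, j) and as (j, i), with the same generator. *)
Definition ideal_Gk (e : rel 'I_n) (k : nat) : {mpoly K[n]} -> Prop :=
  ideal_add (ideal_nk k)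
    (ideal_gen (fun ij : 'I_n * 'I_n => e ij.1 ij.2)
       (fun ij => \sum_(a < k) 'X_(ij.1) ^+ (k.-1 - a) * 'X_(ij.2) ^+ a)).

Definition hsum (U : {set 'I_n}) (d : nat) : {mpoly K[n]} :=
  \sum_(m : 'X_{1..n < d.+1} |
        (mdeg m == d) && [forall i, (i \notin U) ==> (m i == 0%N)]) 'X_[m].

(* If i = m_j then j = (index i ms).+1 and m_j, ..., m_l = drop j.-1 ms. *)
Definition nu_basis (k : nat) (C : finType) (nu : {ffun 'I_n -> C})
    (i : 'I_n) : {mpoly K[n]} :=
  let ms := class_maxs nu in
  let l := num_colors nu in
  let j := (index i ms).+1 in
  if i \in ms then
    if j == l then 'X_i ^+ k - 1
    else hsum [set v in drop j.-1 ms] (k - l + j)%N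
  else 'X_i - 'X_(max_class nu i).
End GraphIdeals.

(* Main.v *)
Require Import Defs.
From mathcomp Require Import all_boot all_order all_fingroup all_algebra.
From mathcomp Require Import separable cyclotomic.
From mathcomp Require Import mpoly ring.

Set Implicit Arguments.
Unset Strict Implicit.
Unset Printing Implicit Defensive.

Import GRing.Theory.
Local Open Scope ring_scope.

(** As [k] is nonzero in the algebraically closed field [K], the polynomial
[T^k - 1] has [k] distinct roots there, and a bijection [r] from the colors to
these roots turns each coloring [mu] into the point of [K^n] with coordinates
[r (mu i)]. These points are the zeros of [ideal_nk k]. Since the roots are
simple, Lagrange interpolation gives, for each coloring, a polynomial,
idempotent modulo [ideal_nk k], that is 1 at that coloring and 0 at the others,
and every polynomial is congruent to the combination of these idempotents given
by its values. So an ideal that contains [ideal_nk k] consists of all the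
polynomials that vanish at its zeros ([cut_outP]), and the dimension of its
quotient is the number of its zeros ([quotient_dim_cut_out],
[leq_quotient_dim]).

The statements are then about sets of colorings. The zeros of [ideal_Gk e k] are
the proper colorings ([cut_out_ideal_Gk]). The zeros of the ideal of the
[nu]-basis are the [k!] colorings obtained from [nu] by permuting the colors
([cut_out_nu_basis]), all of which are proper; unique colorability says that
there is no other proper coloring. The graph polynomial vanishes exactly at the
improper colorings ([meval_graph_poly]), so it multiplies the [nu]-basis into
[ideal_nk k] iff the [nu]-basis vanishes at every proper coloring.

The [nu]-basis is understood through Newton interpolation. Let [y_1, ..., y_k]
be the variables of the maxima of the color classes; the basis elements at the
other vertices make a zero constant on each class. The basis element of index
[m_j] is the divided difference of [T^k - 1] at the points [y_k, ..., y_j],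
hence Newton's formula expresses [T^k - 1 - (T - y_1) ... (T - y_k)] as a
combination of these elements ([newton_nu_basis]). For [T = y_j] it shows that
[y_j^k - 1] lies in the ideal that they generate; at a zero, it shows that the
values of the [y_j] are all the roots of [T^k - 1], so that the [k] classes of
[nu] receive [k] distinct colors. Conversely the divided differences vanish at
any arrangement of the [k] roots ([newton_coef_roots_eq0]). *)

(** * Ideals as predicates *)

Section IdealTheory.
Variable A : comNzRingType.
Implicit Types (J : A -> Prop) (a p q : A).

Record is_ideal J : Prop := IsIdeal {
  ideal0 : J 0;
  idealD : forall p q, J p -> J q -> J (p + q);
  idealM : forall a p, J p -> J (a * p) }.

Lemma idealN J p : is_ideal J -> J p -> J (- p).
Proof. by move=> idJ Jp; rewrite -mulN1r; apply: idealM. Qed.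

Lemma idealB J p q : is_ideal J -> J p -> J q -> J (p - q).
Proof. by move=> idJ Jp Jq; apply: idealD => //; apply: idealN. Qed.

Lemma ideal_sum J (T : Type) (s : seq T) (P : pred T) (F : T -> A) :
  is_ideal J -> (forall t, P t -> J (F t)) -> J (\sum_(t <- s | P t) F t).
Proof. by move=> [J0 JD _] JF; apply: big_ind. Qed.

Lemma is_ideal_gen (T : finType) (P : pred T) (F : T -> A) :
  is_ideal (ideal_gen P F).
Proof.
split.
- by exists (fun=> 0); rewrite big1 // => t _; rewrite mul0r.
- move=> _ _ [c ->] [d ->]; exists (fun t => c t + d t).
  by rewrite -big_split; apply: eq_bigr => t _; rewrite mulrDl.
move=> a _ [c ->]; exists (fun t => a * c t).
by rewrite mulr_sumr; apply: eq_bigr => t _; rewrite mulrA.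
Qed.

Lemma ideal_gen_mem (T : finType) (P : pred T) (F : T -> A) t :
  P t -> ideal_gen P F (F t).
Proof.
move=> Pt; exists (fun u => (u == t)%:R).
rewrite (bigD1 t) //= eqxx mul1r big1 ?addr0 // => u /andP[_ /negPf ->].
by rewrite mul0r.
Qed.

Lemma ideal_gen_min (T : finType) (P : pred T) (F : T -> A) J :
  is_ideal J -> (forall t, P t -> J (F t)) -> forall p, ideal_gen P F p -> J p.
Proof.
move=> idJ JF _ [c ->]; apply: ideal_sum => // t Pt.
by apply: (idealM idJ); apply: JF.
Qed.

Lemma is_ideal_add I J : is_ideal I -> is_ideal J -> is_ideal (ideal_add I J).
Proof.
move=> idI idJ; split.
- by exists 0, 0; split; rewrite ?addr0 //; apply: ideal0.
- move=> _ _ [a [b [Ia Jb ->]]] [a' [b' [Ia' Jb' ->]]].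
  by exists (a + a'), (b + b'); rewrite addrACA; split=> //; apply: idealD.
move=> c _ [a [b [Ia Jb ->]]].
by exists (c * a), (c * b); rewrite mulrDr; split=> //; apply: idealM.
Qed.

Lemma ideal_add_subl I J p : is_ideal J -> I p -> ideal_add I J p.
Proof. by move=> idJ Ip; exists p, 0; rewrite addr0; split=> //; apply: ideal0. Qed.

Lemma ideal_add_subr I J p : is_ideal I -> J p -> ideal_add I J p.
Proof. by move=> idI Jp; exists 0, p; rewrite add0r; split=> //; apply: ideal0. Qed.

End IdealTheory.

Lemma is_ideal_preim (A B : comNzRingType) (f : {rmorphism A -> B})
    (J : B -> Prop) :
  is_ideal J -> is_ideal (fun p => J (f p)).
Proof.
move=> idJ; split=> [|p q Jp Jq|a p Jp].
- by rewrite rmorph0; apply: ideal0.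
- by rewrite rmorphD; apply: idealD.
by rewrite rmorphM; apply: idealM.
Qed.

Lemma is_ideal_zero (A : comNzRingType) : is_ideal (fun p : A => p = 0).
Proof. by split=> // [p q -> ->|a p ->]; rewrite ?addr0 ?mulr0. Qed.

(** * Complete homogeneous polynomials and Newton interpolation *)

Section CompleteHomogeneous.
Variable A : comNzRingType.
Implicit Types (x y : A) (s : seq A).

(** Lists suit the inductions below better than sets of variables; the link
with [hsum] is [hsum_complete_hom]. *)
Fixpoint complete_hom s (d : nat) : A :=
  if s is y :: s' then \sum_(i < d.+1) y ^+ i * complete_hom s' (d - i)
  else (d == 0%N)%:R.

Lemma complete_hom0 s : complete_hom s 0 = 1.
Proof. by elim: s => //= y s IHs; rewrite big_ord1 mul1r. Qed.

Lemma complete_homS y s d :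
  complete_hom (y :: s) d.+1 = complete_hom s d.+1 + y * complete_hom (y :: s) d.
Proof.
rewrite /= big_ord_recl mul1r mulr_sumr; congr (_ + _).
by apply: eq_bigr => i _; rewrite exprS mulrA.
Qed.

Arguments complete_hom : simpl never.

Lemma complete_hom1 y d : complete_hom [:: y] d = y ^+ d.
Proof.
elim: d => [|d IHd]; first by rewrite complete_hom0.
by rewrite complete_homS IHd add0r exprS.
Qed.

(** The complete homogeneous polynomials are the divided differences of the
powers: both sides satisfy the recurrence [complete_homS] in the degree. *)
Lemma complete_hom_divided_diff x y s d :
  (x - y) * complete_hom (x :: y :: s) d
    = complete_hom (x :: s) d.+1 - complete_hom (y :: s) d.+1.
Proof.
elim: d => [|d IHd]; first by rewrite !complete_homS !complete_hom0; ring.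
rewrite complete_homS mulrDr [_ * (x * _)]mulrCA IHd.
rewrite [complete_hom (x :: s) d.+2]complete_homS.
rewrite [complete_hom (y :: s) d.+2]complete_homS; ring.
Qed.

(** For a nonempty [s], the divided difference of [T^k - 1] at the points of
[s]: the constant [-1] only contributes to a divided difference at one point. *)
Definition newton_coef k s : A := complete_hom s (k.+1 - size s) - (size s == 1%N)%:R.

(** Newton's formula for [T^k - 1], with remainder, modulo an ideal that
contains the coefficients: adding a node [y] to [s] splits the remainder into a
new coefficient and a new remainder, by [complete_hom_divided_diff]. The
constant [-1] enters with the first node. The zero ideal is the case where these
divided differences vanish. *)
Lemma newton_interpolation (J : A -> Prop) k s x :
    is_ideal J -> (size s <= k)%N ->
    (forall i, (i < size s)%N -> J (newton_coef k (drop i s))) ->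
  J (x ^+ k - (s != [::])%:R
       - (\prod_(y <- s) (x - y)) * complete_hom (x :: s) (k - size s)).
Proof.
move=> idJ; elim: s => [|y s IHs] /= size_s Js.
  by rewrite big_nil mul1r subn0 subr0 complete_hom1 subrr; apply: ideal0.
have{IHs} := IHs (ltnW size_s) (fun i => Js i.+1).
have Jy := Js 0%N isT; rewrite drop0 /newton_coef /= subSS in Jy.
set P := \prod_(_ <- _) _; move=> Jtail.
have step : (x - y) * complete_hom (x :: y :: s) (k - (size s).+1)
    = complete_hom (x :: s) (k - size s) - complete_hom (y :: s) (k - size s).
  by rewrite complete_hom_divided_diff subnSK.
rewrite big_cons -/P (_ : _ - _ = x ^+ k - (s != [::])%:R
    - P * complete_hom (x :: s) (k - size s)
    + P * (complete_hom (y :: s) (k - size s) - (size s == 0%N)%:R)).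
  by apply: idealD => //; apply: idealM.
rewrite [_ * P]mulrC -mulrA step {Jtail Jy step Js}.
have P1 : P * (s == [::])%:R = (s == [::])%:R.
  by rewrite /P; case: (s) => [|z t]; rewrite ?big_nil ?mul1r ?mulr0.
rewrite size_eq0 !mulrBr P1; case: (s == [::]) => /=; ring.
Qed.

(** With [k] nodes the cofactor in the remainder has degree 0, so it is 1. *)
Lemma newton_interpolation_full (J : A -> Prop) k s x :
    is_ideal J -> (0 < k)%N -> size s = k ->
    (forall i, (i < k)%N -> J (newton_coef k (drop i s))) ->
  J (x ^+ k - 1 - \prod_(y <- s) (x - y)).
Proof.
move=> idJ k_gt0 size_s Js.
have := @newton_interpolation J k s x idJ.
rewrite size_s subnn complete_hom0 mulr1 -size_eq0 size_s -lt0n k_gt0.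
exact.
Qed.

End CompleteHomogeneous.
Arguments complete_hom : simpl never.

Lemma rmorph_complete_hom (A B : comNzRingType) (f : {rmorphism A -> B}) s d :
  f (complete_hom s d) = complete_hom (map f s) d.
Proof.
elim: s d => [|y s IHs] d; first exact: rmorph_nat.
rewrite /complete_hom -/complete_hom.
by rewrite rmorph_sum; apply: eq_bigr => i _; rewrite rmorphM rmorphXn IHs.
Qed.

Lemma rmorph_newton_coef (A B : comNzRingType) (f : {rmorphism A -> B}) k s :
  f (newton_coef k s) = newton_coef k (map f s).
Proof. by rewrite rmorphB rmorph_nat rmorph_complete_hom /newton_coef size_map. Qed.

(** Divided differences of [T^k - 1] vanish on distinct zeros of [T^k - 1]. Here
this follows from Newton's formula on a nonempty tail [s], evaluated at the new
node [y]: the coefficients on [s] vanish by induction, hence so does the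
remainder, which is [newton_coef k (y :: s)] times the nonzero product of the
[y - z] for [z] in [s]. *)
Lemma newton_coef_roots_eq0 (A : idomainType) k (s : seq A) :
    uniq s -> (size s <= k)%N -> (forall y, y \in s -> y ^+ k = 1) ->
  newton_coef k s = 0.
Proof.
have [m] := ubnP (size s); elim: m s => // m IHm [|y s] /= size_s.
  by rewrite /newton_coef subrr.
case/andP=> y_s uniq_s size_le root_s; have{IHm} tail0 i :
    (i < size s)%N -> newton_coef k (drop i s) = 0.
  move=> lt_i; apply: IHm.
  - by rewrite size_drop (leq_ltn_trans (leq_subr _ _)).
  - exact: drop_uniq.
  - by rewrite size_drop (leq_trans (leq_subr _ _)) // ltnW.
  by move=> z /mem_drop z_s; apply: root_s; rewrite in_cons z_s orbT.
have := newton_interpolation y (is_ideal_zero A) (ltnW size_le) tail0.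
rewrite root_s ?mem_head // /newton_coef /= subSS.
case: s {size_s tail0 root_s} y_s size_le uniq_s => [|z s] y_s size_le uniq_s.
  by rewrite /= big_nil mul1r subr0 => /eqP; rewrite subr_eq0 => /eqP <-; rewrite subrr.
rewrite subrr sub0r => /eqP; rewrite oppr_eq0 mulf_eq0 subr0 => /orP[|/eqP //].
rewrite prodf_seq_eq0 => /hasP[t t_s /=]; rewrite subr_eq0 => /eqP eq_yt.
by rewrite eq_yt t_s in y_s.
Qed.

(** * The sum of all monomials of given degree *)

Section HSum.
Variables (K : fieldType) (n : nat).
Implicit Types (U : {set 'I_n}) (v : 'I_n).

Lemma mcoeff_hsum U d (m : 'X_{1..n}) :
  (hsum K U d)@_m
    = ((mdeg m == d) && [forall i, (i \notin U) ==> (m i == 0%N)])%:R.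
Proof.
rewrite raddf_sum /=; case: (boolP (_ && _)) => [Pm | notPm].
  have lt_m : (mdeg m < d.+1)%N by case/andP: Pm => /eqP ->.
  rewrite (bigD1 (BMultinom lt_m)) //= mcoeffX eqxx big1 ?addr0 //.
  move=> m' /andP[_ neq].
  rewrite mcoeffX; case: eqP => // eq_m; case/eqP: neq.
  by apply: val_inj.
rewrite big1 // => m' Pm'; rewrite mcoeffX; case: eqP => // eq_m.
by rewrite -eq_m Pm' in notPm.
Qed.

Lemma hsum_set0 d : hsum K (n := n) set0 d = (d == 0%N)%:R.
Proof.
apply/mpolyP => m; rewrite mcoeff_hsum mcoeffMn mcoeff1.
have -> : [forall i, (i \notin set0) ==> (m i == 0%N)] = (m == 0%MM).
  apply/forallP/eqP => [m0|-> i]; last by rewrite mnm0E eqxx implybT.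
  by apply/mnmP => i; have:= m0 i; rewrite inE mnm0E => /eqP.
case: (m =P 0%MM) => [->|_]; last by rewrite andbF mul0rn.
by rewrite mdeg0 andbT eq_sym.
Qed.

Lemma hsum0 U : hsum K U 0 = 1.
Proof.
apply/mpolyP => m; rewrite mcoeff_hsum mcoeff1 mdeg_eq0.
case: (m =P 0%MM) => //= ->; rewrite (introT forallP) // => i.
by rewrite mnm0E eqxx implybT.
Qed.

(** The monomials of degree [d.+1] in [v |: U] either avoid ['X_v], or are
['X_v] times a monomial of degree [d]. *)
Lemma hsum_setU1 U v d : v \notin U ->
  hsum K (v |: U) d.+1 = hsum K U d.+1 + 'X_v * hsum K (v |: U) d.
Proof.
move=> vU; apply/mpolyP => m; rewrite mcoeffD !mcoeff_hsum.
have [m_v | m_v] := eqVneq (m v) 0%N.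
  rewrite [X in _ + X](_ : _ = 0) ?addr0.
    congr (nat_of_bool (_ && _))%:R; apply: eq_forallb => i; rewrite !inE.
    by have [->|_] //= := eqVneq i v; rewrite m_v eqxx implybT.
  apply: memN_msupp_eq0; rewrite mulrC (perm_mem (msuppMX _ _)).
  apply/mapP => -[m' _ eq_m]; move: m_v; rewrite eq_m mnmDE mnm1E eqxx.
  by rewrite addSn.
have eq_m : m = (U_(v) + (m - U_(v)))%MM.
  apply/mnmP => i; rewrite mnmDE mnmBE mnm1E; case: eqP => [<-|_] /=.
    by rewrite subnKC // lt0n.
  by rewrite subn0.
have -> : ('X_v * hsum K (v |: U) d)@_m = (hsum K (v |: U) d)@_(m - U_(v)).
  by rewrite [in LHS]eq_m mulrC mcoeffMX.
rewrite mcoeff_hsum.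
have -> : [forall i, (i \notin U) ==> (m i == 0%N)] = false.
  by apply/negbTE/forallPn; exists v; rewrite vU.
rewrite andbF add0r (congr1 mdeg eq_m) mdegD mdeg1 add1n eqSS.
congr (nat_of_bool (_ && _))%:R; apply: eq_forallb => i.
rewrite !inE mnmBE mnm1E eq_sym; case: eqP => //= _; by rewrite subn0.
Qed.

Lemma hsum_complete_hom (s : seq 'I_n) d : uniq s ->
  hsum K [set v in s] d = complete_hom [seq 'X_v | v <- s] d.
Proof.
elim: s d => [|v s IHs] d /=; first by rewrite set_nil hsum_set0.
case/andP=> v_s uniq_s; rewrite set_cons.
elim: d => [|d IHd]; first by rewrite hsum0 complete_hom0.
by rewrite hsum_setU1 ?inE // complete_homS IHs // IHd.
Qed.

End HSum.

(** * Ideals cut out by colorings *)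

Section Interpolation.
Variables (K : fieldType) (n k : nat) (C : finType) (r : C -> K).
Hypothesis r_inj : injective r.
Hypothesis C_gt0 : (0 < #|C|)%N.
Hypothesis r_split : 'X^k - 1 = \prod_c ('X - (r c)%:P).
Implicit Types (mu : {ffun 'I_n -> C}) (S : {set {ffun 'I_n -> C}}).
Implicit Types (c : C) (p : {mpoly K[n]}) (J : {mpoly K[n]} -> Prop).

Definition color_point mu (i : 'I_n) : K := r (mu i).

(** Only colorings are considered as zeros: an ideal that contains [ideal_nk k]
has no others. *)
Definition cut_out J S : Prop :=
  forall p, J p <-> forall mu, mu \in S -> p.@[color_point mu] = 0.

Lemma root_expr c : r c ^+ k = 1.
Proof.
apply/eqP; rewrite -subr_eq0; have /(congr1 (horner^~ (r c))) := r_split.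
rewrite hornerD hornerN hornerXn hornerC horner_prod (bigD1 c) //= => ->.
by rewrite hornerXsubC subrr mul0r.
Qed.

Definition lagrange_poly c : {poly K} :=
  \prod_(d | d != c) ((r c - r d)^-1 *: ('X - (r d)%:P)).

Lemma horner_lagrange c d : (lagrange_poly c).[r d] = (d == c)%:R.
Proof.
rewrite horner_prod; case: eqVneq => [->|neq_dc].
  rewrite big1 // => b neq_bc; rewrite hornerZ hornerXsubC mulVf //.
  by rewrite subr_eq0 (inj_eq r_inj) eq_sym.
by rewrite (bigD1 d) //= hornerZ hornerXsubC subrr mulr0 mul0r.
Qed.

Lemma XsubC_lagrange c :
  ('X - (r c)%:P) * lagrange_poly c
    = (\prod_(d | d != c) (r c - r d)^-1) *: ('X^k - 1).
Proof.
rewrite /lagrange_poly scaler_prod -scalerAr; congr (_ *: _).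
by rewrite r_split [in RHS](bigD1 c).
Qed.

(** The difference has degree less than [#|C|] and vanishes at the [#|C|] values
of [r]. *)
Lemma sum_lagrange : \sum_c lagrange_poly c = 1.
Proof.
apply/eqP; rewrite -subr_eq0; apply/eqP.
apply: (@roots_geq_poly_eq0 _ _ (map r (enum C))).
- apply/allP => _ /mapP[d _ ->]; rewrite rootE hornerD hornerN hornerC horner_sum.
  rewrite (bigD1 d) //= horner_lagrange eqxx big1 ?addr0 ?subrr // => c.
  by rewrite horner_lagrange eq_sym => /negPf ->.
- by rewrite map_inj_uniq ?enum_uniq.
rewrite size_map -cardE (leq_trans (size_polyD _ _)) // geq_max size_polyN.
have size_lagrange c : (size (lagrange_poly c) <= #|C|)%N.
  rewrite /lagrange_poly scaler_prod (leq_trans (size_scale_leq _ _)) //.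
  rewrite -big_filter size_prod_XsubC size_filter -sum1_count sum1_card cardC1.
  by rewrite prednK //; apply/card_gt0P; exists c.
rewrite size_polyC oner_eq0 /= (leq_trans (size_sum _ _ _)) //=.
  by apply/bigmax_leqP => c _; apply: size_lagrange.
Qed.


Definition indicator mu : {mpoly K[n]} :=
  \prod_i horner_alg 'X_i (lagrange_poly (mu i)).

Lemma meval_horner_alg (a : 'I_n -> K) i (q : {poly K}) :
  (horner_alg ('X_i : {mpoly K[n]}) q).@[a] = q.[a i].
Proof.
elim/poly_ind: q => [|q c IHq]; first by rewrite rmorph0 meval0 horner0.
rewrite rmorphD rmorphM /= horner_algX horner_algC mevalD mevalM mevalXU IHq.
by rewrite mevalZ meval1 mulr1 hornerMXaddC.
Qed.

Lemma meval_indicator mu mu' :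
  (indicator mu).@[color_point mu'] = (mu' == mu)%:R.
Proof.
rewrite rmorph_prod; case: eqVneq => [->|neq_mu].
  by rewrite big1 // => i _; rewrite /= meval_horner_alg horner_lagrange eqxx.
have /existsP[i neq_i] : [exists i, mu' i != mu i].
  rewrite -negb_forall; apply: contraNN neq_mu => /forallP eq_mu.
  by apply/eqP/ffunP => i; apply/eqP.
by rewrite (bigD1 i) //= meval_horner_alg horner_lagrange (negPf neq_i) mul0r.
Qed.

Lemma sum_indicator : \sum_mu indicator mu = 1.
Proof.
rewrite -(bigA_distr_bigA (fun i c => horner_alg 'X_i (lagrange_poly c))).
by rewrite big1 // => i _; rewrite -rmorph_sum sum_lagrange rmorph1.
Qed.

(** Modulo [J], the polynomials congruent to their value at [a] form a subring
that contains the constants and the variables. *)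
Lemma ideal_subC_meval J (a : 'I_n -> K) p :
  is_ideal J -> (forall i, J ('X_i - (a i)%:MP)) -> J (p - (p.@[a])%:MP).
Proof.
move=> idJ Ja.
have JM (q s : {mpoly K[n]}) : J (q - (q.@[a])%:MP) -> J (s - (s.@[a])%:MP) ->
    J (q * s - ((q * s).@[a])%:MP).
  move=> Jq Js; rewrite mevalM mpolyCM.
  rewrite (_ : _ - _ = q * (s - (s.@[a])%:MP) + (s.@[a])%:MP * (q - (q.@[a])%:MP)).
    by apply: idealD => //; apply: idealM.
  by ring.
have JD (q s : {mpoly K[n]}) : J (q - (q.@[a])%:MP) -> J (s - (s.@[a])%:MP) ->
    J (q + s - ((q + s).@[a])%:MP).
  by move=> Jq Js; rewrite mevalD mpolyCD opprD addrACA; apply: idealD.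
have JC (c : K) : J (c%:MP - ((c%:MP_[n]).@[a])%:MP).
  by rewrite mevalC subrr; apply: ideal0.
have JX i d : J ('X_i ^+ d - (('X_i ^+ d : {mpoly K[n]}).@[a])%:MP).
  elim: d => [|d IHd]; first by rewrite expr0; apply: (JC 1).
  by rewrite exprS; apply: JM => //; rewrite mevalXU.
rewrite [p]mpolyE; elim/big_ind: _ => [||m _]; first by rewrite -mpolyC0; apply: JC.
  exact: JD.
rewrite -mul_mpolyC; apply: (JM) => //; rewrite mpolyXE_id.
by elim/big_ind: _ => [|q s|i _] //; [apply: (JC 1) | apply: JM].
Qed.

(** Modulo [J], multiplying the indicator of [mu] by a polynomial is evaluating
that polynomial at [mu]: ['X_i - r (mu i)] kills the indicator, as its product
with the [i]-th factor is a multiple of ['X_i ^+ k - 1]. *)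
Lemma mul_indicator J mu p : is_ideal J -> (forall i, J ('X_i ^+ k - 1)) ->
  J (p * indicator mu - p.@[color_point mu] *: indicator mu).
Proof.
move=> idJ JX; rewrite -mul_mpolyC -mulrBl.
apply: (@ideal_subC_meval (fun q => J (q * indicator mu))) => [|i].
  split=> [|q s Jq Js|a q Jq]; first by rewrite mul0r; apply: ideal0.
    by rewrite mulrDl; apply: idealD.
  by rewrite -mulrA; apply: idealM.
rewrite /indicator (bigD1 i) //= mulrA; set rest := \prod_(_ | _) _.
have -> : 'X_i - (color_point mu i)%:MP
    = horner_alg 'X_i ('X - (r (mu i))%:P) :> {mpoly K[n]}.
  by rewrite rmorphB /= horner_algX horner_algC alg_mpolyC.
rewrite -rmorphM XsubC_lagrange /= linearZ rmorphB rmorphXn rmorph1 /=.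
rewrite horner_algX mulrC; apply: idealM => //.
by rewrite -mul_mpolyC; apply: idealM.
Qed.

(** The indicators outside [S] lie in [J]: if [f] in [J] does not vanish at
[mu], then [f * indicator mu] is congruent to a nonzero multiple of
[indicator mu]. So [p], congruent to the combination of the indicators with its
values as coefficients, lies in [J] as soon as it vanishes on [S]. *)
Lemma cut_outP J S :
    is_ideal J -> (forall i, J ('X_i ^+ k - 1)) ->
    (forall mu p, mu \in S -> J p -> p.@[color_point mu] = 0) ->
    (forall mu, mu \notin S -> exists2 f, J f & f.@[color_point mu] != 0) ->
  cut_out J S.
Proof.
move=> idJ JX JS0 JSN p; split=> [Jp mu muS | p0]; first exact: JS0 Jp.
rewrite -[p]mulr1 -sum_indicator mulr_sumr; apply: ideal_sum => // mu _.
have := mul_indicator mu p idJ JX; have [muS | /JSN[f Jf f_neq0]] := boolP (mu \in S).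
  by rewrite p0 // scale0r subr0.
move=> _; apply: idealM => //.
have /(idealB idJ (idealM idJ (indicator mu) Jf)) := mul_indicator mu f idJ JX.
rewrite mulrC opprB addrC subrK => /(idealM idJ ((f.@[color_point mu])^-1)%:MP).
by rewrite mul_mpolyC scalerA mulVf // scale1r.
Qed.

Section QuotientDimension.
Variables (J : {mpoly K[n]} -> Prop) (S : {set {ffun 'I_n -> C}}).
Hypothesis JS : cut_out J S.

(** The indicators of the points of [S] form a basis of the quotient. *)
Lemma quotient_dim_cut_out : quotient_dim J #|S|.
Proof.
exists (fun i => indicator (enum_val i)).
have meval_comb (c : 'I_#|S| -> K) j :
    (\sum_i c i *: indicator (enum_val i)).@[color_point (enum_val j)] = c j.
  rewrite rmorph_sum (bigD1 j) //= mevalZ meval_indicator eqxx mulr1.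
  rewrite big1 ?addr0 // => i neq_ij; rewrite mevalZ meval_indicator.
  by rewrite (inj_eq enum_val_inj) eq_sym (negPf neq_ij) mulr0.
split=> [p | c Jc j]; last by rewrite -(meval_comb c) (proj1 (JS _) Jc) ?enum_valP.
exists (fun i => p.@[color_point (enum_val i)]); apply/JS => mu muS.
by rewrite mevalB -(enum_rankK_in muS muS) meval_comb subrr.
Qed.

(** If [d] elements span the quotient, writing the indicators of [S] in terms of
them and evaluating on [S] factors the identity matrix of size [#|S|] through
[K^d]. *)
Lemma leq_quotient_dim d : quotient_dim J d -> (#|S| <= d)%N.
Proof.
case=> b [spanb _].
have /fin_all_exists[c cP] (j : 'I_#|S|) :
    exists c : 'I_d -> K, J (indicator (enum_val j) - \sum_i c i *: b i).
  exact: spanb.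
apply: (@mulmx1_min K _ _ (\matrix_(j, i) c j i)
  (\matrix_(i, j) (b i).@[color_point (enum_val j)])).
apply/matrixP => j j'; rewrite !mxE.
have /eqP := proj1 (JS _) (cP j) _ (enum_valP j'); rewrite mevalB subr_eq0 => /eqP.
rewrite meval_indicator (inj_eq enum_val_inj) eq_sym => ->.
by rewrite rmorph_sum; apply: eq_bigr => i _; rewrite !mxE /= mevalZ.
Qed.

End QuotientDimension.

End Interpolation.

(** * Colors as roots of unity *)

Lemma exists_root_labelling (K : closedFieldType) (C : finType) :
    #|C|%:R != 0 :> K ->
  exists2 r : C -> K, injective r
    & 'X^#|C| - 1 = \prod_c ('X - (r c)%:P) :> {poly K}.
Proof.
move=> C_neq0; have C_gt0 : (0 < #|C|)%N.
  by rewrite lt0n; apply: contraNneq C_neq0 => ->.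
have [s] := closed_field_poly_normal ('X^#|C| - 1 : {poly K}).
rewrite (monicP (monicXnsubC 1 C_gt0)) scale1r => def_s.
have size_s : size s = #|C|.
  by apply: succn_inj; rewrite -(size_prod_XsubC s id) -def_s size_XnsubC.
have uniq_s : uniq s by rewrite -separable_prod_XsubC -def_s separable_Xn_sub_1.
exists (fun c => s`_(enum_rank c)) => [c d /eqP|].
  by rewrite nth_uniq ?size_s // => /eqP/val_inj/enum_rank_inj.
rewrite def_s (big_nth 0) size_s big_mkord.
by rewrite (reindex enum_rank) //; apply/onW_bij/enum_rank_bij.
Qed.

(** * Color classes and recolorings *)

Section ColorClasses.
Variables (n : nat) (C : finType) (nu : {ffun 'I_n -> C}).

Lemma max_classP i :
  nu (max_class nu i) = nu i /\ forall j, nu j = nu i -> (j <= max_class nu i)%N.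
Proof.
rewrite /max_class; case: arg_maxnP => [|m]; rewrite ?inE // => /eqP nu_m max_m.
by split=> // j /eqP nu_j; apply: max_m; rewrite inE.
Qed.

Lemma nu_max_class i : nu (max_class nu i) = nu i.
Proof. by case: (max_classP i). Qed.

Lemma eq_max_class i j : nu i = nu j -> max_class nu i = max_class nu j.
Proof.
move=> eq_nu; apply/val_inj/eqP.
have [nu_i max_i] := max_classP i; have [nu_j max_j] := max_classP j.
by rewrite /= eqn_leq max_j ?max_i // ?nu_i ?nu_j.
Qed.

Lemma mem_class_maxs i : (i \in class_maxs nu) = (i == max_class nu i).
Proof. by rewrite mem_filter mem_enum andbT. Qed.

Lemma max_class_mem i : max_class nu i \in class_maxs nu.
Proof. by rewrite mem_class_maxs; apply/eqP/eq_max_class/esym/nu_max_class. Qed.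

Lemma uniq_class_maxs : uniq (class_maxs nu).
Proof. exact/filter_uniq/enum_uniq. Qed.

Lemma nu_inj_class_maxs : {in class_maxs nu &, injective nu}.
Proof.
move=> i j; rewrite !mem_class_maxs => /eqP-> /eqP->.
by rewrite !nu_max_class => /eq_max_class.
Qed.

Hypothesis nu_surj : forall c, c \in codom nu.

Lemma num_colors_surj : num_colors nu = #|C|.
Proof. by apply: eq_card => c; rewrite nu_surj. Qed.

Lemma size_class_maxs : size (class_maxs nu) = #|C|.
Proof.
rewrite -(size_map nu) cardE; apply/perm_size/uniq_perm; rewrite ?enum_uniq //.
  by rewrite map_inj_in_uniq ?uniq_class_maxs //; apply: nu_inj_class_maxs.
move=> c; rewrite mem_enum; apply/mapP.
have /codomP[i ->] := nu_surj c; exists (max_class nu i); first exact: max_class_mem.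
by rewrite nu_max_class.
Qed.

Definition recolorings : {set {ffun 'I_n -> C}} :=
  [set [ffun i => s (nu i)] | s : {perm C}].

Lemma recoloringsP (mu : {ffun 'I_n -> C}) :
  reflect (exists s : {perm C}, forall i, mu i = s (nu i)) (mu \in recolorings).
Proof.
apply: (iffP imsetP) => [[s _ ->] | [s def_mu]].
  by exists s => i; rewrite ffunE.
by exists s => //; apply/ffunP => i; rewrite ffunE.
Qed.

Lemma card_recolorings : #|recolorings| = #|C|`!.
Proof.
rewrite card_imset => [|s t /ffunP eq_st]; last first.
  apply/permP => c; have /codomP[i ->] := nu_surj c.
  by have := eq_st i; rewrite !ffunE.
rewrite -[in RHS]cardsT -card_perm; apply: eq_card => s.
by rewrite inE; apply/esym/subsetP => c _; rewrite inE.
Qed.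

(** Such a [mu] factors through [nu] by a surjective map from [C] to itself,
which is a permutation. *)
Lemma recoloring_of_surj (mu : {ffun 'I_n -> C}) :
    (forall i j, nu i = nu j -> mu i = mu j) -> (forall c, c \in codom mu) ->
  mu \in recolorings.
Proof.
move=> mu_nu mu_surj; apply/recoloringsP.
pose f c := mu (iinv (nu_surj c)).
have def_mu i : mu i = f (nu i) by apply: mu_nu; rewrite f_iinv.
have f_surj c : c \in codom f.
  by have /codomP[i ->] := mu_surj c; rewrite def_mu codom_f.
have f_inj : injective f.
  apply/injectiveP/card_uniqP; rewrite size_map -cardE.
  by apply: eq_card => c; rewrite f_surj.
by exists (perm f_inj) => i; rewrite permE.
Qed.
End ColorClasses.

(** * Proper colorings *)

Section GraphColorings.
Variables (n : nat) (C : finType) (e : rel 'I_n).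

Definition proper_colorings : {set {ffun 'I_n -> C}} :=
  [set mu : {ffun 'I_n -> C} | [forall i, forall j, e i j ==> (mu i != mu j)]].

Lemma proper_coloringsP (mu : {ffun 'I_n -> C}) :
  reflect (proper_coloring e mu) (mu \in proper_colorings).
Proof.
rewrite inE; apply: (iffP forallP) => [mu_e i j eij | mu_e i].
  by have /forallP/(_ j)/implyP/(_ eij) := mu_e i.
by apply/forallP => j; apply/implyP/mu_e.
Qed.

Lemma improperP (mu : {ffun 'I_n -> C}) : mu \notin proper_colorings ->
  exists2 ij : 'I_n * 'I_n, e ij.1 ij.2 & mu ij.1 = mu ij.2.
Proof.
rewrite inE => /forallPn[i /forallPn[j]].
by rewrite negb_imply negbK => /andP[eij /eqP]; exists (i, j).
Qed.

Lemma recolorings_proper (nu : {ffun 'I_n -> C}) : proper_coloring e nu ->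
  recolorings nu \subset proper_colorings.
Proof.
move=> nu_e; apply/subsetP => mu /recoloringsP[s def_mu].
by apply/proper_coloringsP => i j /nu_e; rewrite !def_mu (inj_eq perm_inj).
Qed.

Lemma uniquely_colorableP (nu : {ffun 'I_n -> C}) : proper_coloring e nu ->
  uniquely_colorable C e <-> proper_colorings = recolorings nu.
Proof.
move=> nu_e; split=> [[_ uniq_e] | eq_col].
  apply/eqP; rewrite eqEsubset recolorings_proper // andbT.
  apply/subsetP => mu /proper_coloringsP mu_e; apply/recoloringsP; exact: uniq_e.
split=> [|mu mu' /proper_coloringsP + /proper_coloringsP]; first by exists nu.
rewrite eq_col => /recoloringsP[s def_mu] /recoloringsP[t def_mu'].
by exists (s^-1 * t)%g => i; rewrite permM def_mu permK.
Qed.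
End GraphColorings.

(** * The coloring ideals and the graph polynomial *)

Section GraphIdealTheory.
Variables (K : fieldType) (n : nat) (C : finType) (r : C -> K).
Hypothesis r_inj : injective r.
Hypothesis C_neq0 : #|C|%:R != 0 :> K.
Hypothesis r_split : 'X^#|C| - 1 = \prod_c ('X - (r c)%:P).
Variables (e : rel 'I_n).
Hypotheses (e_sym : ssrbool.symmetric e) (e_irr : irreflexive e).
Implicit Types (mu : {ffun 'I_n -> C}) (i : 'I_n).

Local Notation k := #|C|.
Local Notation pt := (color_point r).

Let k_gt0 : (0 < k)%N.
Proof. by rewrite lt0n; apply: contraNneq C_neq0 => ->. Qed.

Let root_pt mu i : pt mu i ^+ k = 1.
Proof. exact: (root_expr r_split). Qed.

Lemma ideal_nk_mem i : ideal_nk (K := K) k ('X_i ^+ k - 1).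
Proof. exact: (ideal_gen_mem (fun i : 'I_n => 'X_i ^+ k - 1)). Qed.

Lemma meval_ideal_gen_eq0 (T : finType) (P : pred T) (F : T -> {mpoly K[n]}) a :
  (forall t, P t -> (F t).@[a] = 0) -> forall p, ideal_gen P F p -> p.@[a] = 0.
Proof.
move=> Fa; apply: ideal_gen_min => //.
exact: (is_ideal_preim (meval a) (is_ideal_zero K)).
Qed.

Lemma meval_ideal_nk mu p : ideal_nk k p -> p.@[pt mu] = 0.
Proof.
apply: meval_ideal_gen_eq0 => i _.
by rewrite mevalB meval1 rmorphXn /= mevalXU root_pt subrr.
Qed.

Lemma cut_out_ideal_nk : cut_out r (ideal_nk k) [set: {ffun 'I_n -> C}].
Proof.
apply: (cut_outP r_inj k_gt0 r_split).
- exact: is_ideal_gen.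
- exact: ideal_nk_mem.
- by move=> mu p _; apply: meval_ideal_nk.
by move=> mu; rewrite inE.
Qed.

Lemma is_ideal_Gk : is_ideal (ideal_Gk (K := K) e k).
Proof. by apply: is_ideal_add; apply: is_ideal_gen. Qed.

(** The sum times [x_i - x_j] is [x_i^k - x_j^k], which is 0 at every coloring;
when both ends have the same color, [x_i] times the sum is [k x_i^k = k], which
is nonzero in [K]. *)
Lemma meval_edge_poly mu i j :
  (\sum_(a < k) 'X_i ^+ (k.-1 - a) * 'X_j ^+ a).@[pt mu] = 0 <-> mu i != mu j.
Proof.
rewrite rmorph_sum (eq_bigr (fun a : 'I_k => pt mu i ^+ (k.-1 - a) * pt mu j ^+ a)).
  split=> [sum0 | neq_ij].
    apply/eqP => eq_ij; case/eqP: C_neq0.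
    have /(congr1 ( *%R (pt mu i))) := sum0.
    rewrite mulr0 mulr_sumr => <-; rewrite (eq_bigr (fun=> 1)) => [|a _].
      by rewrite sumr_const card_ord.
    rewrite /color_point -eq_ij -exprD -exprS subnK ?prednK ?(root_expr r_split) //.
    by rewrite -ltnS prednK.
  have := subrXX (pt mu i) (pt mu j) k; rewrite !root_pt subrr => /esym/eqP.
  rewrite mulf_eq0 subr_eq0 => /orP[/eqP/r_inj/eqP|/eqP //].
  by rewrite (negPf neq_ij).
by move=> a _; rewrite rmorphM !rmorphXn /= !mevalXU.
Qed.

Lemma cut_out_ideal_Gk : cut_out r (ideal_Gk e k) (proper_colorings C e).
Proof.
apply: (cut_outP r_inj k_gt0 r_split).
- exact: is_ideal_Gk.
- move=> i; apply: ideal_add_subl; first exact: is_ideal_gen.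
  exact: ideal_nk_mem.
- move=> mu _ /proper_coloringsP mu_e [a [b [Ia Jb ->]]].
  rewrite mevalD meval_ideal_nk // add0r.
  move: b Jb; apply: meval_ideal_gen_eq0 => -[i j] /= eij.
  exact/meval_edge_poly/mu_e.
move=> mu /improperP[[i j] /= eij eq_ij].
exists (\sum_(a < k) 'X_i ^+ (k.-1 - a) * 'X_j ^+ a); last first.
  by apply/eqP => /meval_edge_poly; rewrite eq_ij eqxx.
apply: ideal_add_subr; first exact: is_ideal_gen.
exact: (ideal_gen_mem (fun ij : 'I_n * 'I_n =>
  \sum_(a < k) 'X_(ij.1) ^+ (k.-1 - a) * 'X_(ij.2) ^+ a) (t := (i, j))).
Qed.

Lemma meval_graph_poly mu :
  ((graph_poly K e).@[pt mu] != 0) = (mu \in proper_colorings C e).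
Proof.
rewrite rmorph_prod; apply/idP/idP => [/prodf_neq0 f_neq0 | /proper_coloringsP mu_e].
  apply/proper_coloringsP => i j.
  wlog lt_ij : i j / (i < j)%N => [wlog_ij eij|eij].
    case: (ltngtP i j) => [lt_ij | lt_ji | /val_inj eq_ij].
    - exact: wlog_ij.
    - by rewrite eq_sym wlog_ij // e_sym.
    by rewrite eq_ij e_irr in eij.
  have := f_neq0 i isT; rewrite rmorph_prod => /prodf_neq0/(_ j).
  rewrite eij lt_ij => /(_ isT); rewrite /= mevalB !mevalXU subr_eq0.
  by rewrite (inj_eq r_inj).
apply/prodf_neq0 => i _; rewrite rmorph_prod; apply/prodf_neq0 => j /andP[eij _].
by rewrite /= mevalB !mevalXU subr_eq0 (inj_eq r_inj) mu_e.
Qed.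

(** * The ideal of the nu-basis *)

Section NuBasis.
Variable nu : {ffun 'I_n -> C}.
Hypothesis nu_surj : forall c, c \in codom nu.

Local Notation ms := (class_maxs nu).
Local Notation Xms := [seq 'X_v : {mpoly K[n]} | v <- ms].
Local Notation g := (nu_basis K k nu).

Lemma nu_basis_nonmax i : i \notin ms -> g i = 'X_i - 'X_(max_class nu i).
Proof. by rewrite /nu_basis => /negPf ->. Qed.

(** In both cases of the definition the element attached to a class maximum is
a divided difference of [T^k - 1]; the last maximum gives the single node, where
the constant [-1] shows. *)
Lemma nu_basis_max i : i \in ms -> g i = newton_coef k (drop (index i ms) Xms).
Proof.
move=> i_ms; rewrite /nu_basis i_ms num_colors_surj // subnn add0n.
have lt_ik : (index i ms < k)%N by rewrite -(size_class_maxs nu_surj) index_mem.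
rewrite /newton_coef size_drop size_map size_class_maxs //.
rewrite (_ : k.+1 - (k - index i ms) = (index i ms).+1)%N; last first.
  by rewrite subSn ?leq_subr // subKn // ltnW.
rewrite (_ : (k - index i ms == 1)%N = ((index i ms).+1 == k)); last first.
  by rewrite -[1%N]add0n -(eqn_add2r (index i ms)) subnK 1?ltnW //
    add0n add1n eq_sym.
case: eqP => [eq_k | _].
  rewrite -map_drop (drop_nth i) ?size_class_maxs // nth_index //.
  by rewrite drop_oversize ?size_class_maxs ?eq_k // complete_hom1.
by rewrite subr0 -map_drop hsum_complete_hom ?drop_uniq ?uniq_class_maxs.
Qed.

Lemma newton_coef_nu_basis j : (j < k)%N ->
  exists i, g i = newton_coef k (drop j Xms).
Proof.
move=> lt_jk; have lt_j : (j < size ms)%N by rewrite size_class_maxs.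
have [i0 _] : exists i0, i0 \in ms.
  by case: ms lt_j => // i0 s _; exists i0; apply: mem_head.
exists (nth i0 ms j).
by rewrite nu_basis_max ?mem_nth // index_uniq ?uniq_class_maxs.
Qed.

(** The ring morphism [f] is the identity for membership in the ideal, and an
evaluation for the study of its zeros. *)
Lemma newton_nu_basis (A : comNzRingType) (f : {rmorphism {mpoly K[n]} -> A})
    (J : A -> Prop) (x : A) :
  is_ideal J -> (forall i, J (f (g i))) ->
  J (x ^+ k - 1 - \prod_(y <- map f Xms) (x - y)).
Proof.
move=> idJ Jg; apply: newton_interpolation_full => //.
  by rewrite !size_map size_class_maxs.
move=> j /newton_coef_nu_basis[i def_g].
by rewrite -map_drop -rmorph_newton_coef -def_g.
Qed.

(** For a class maximum [m], Newton's formula at [T = 'X_m] has no product term.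
Any other vertex is congruent to the maximum of its class. *)
Lemma ideal_nu_basis_nk i : ideal_gen xpredT g ('X_i ^+ k - 1).
Proof.
set J := ideal_gen _ _; have idJ : is_ideal J by apply: is_ideal_gen.
have Jg j : J (g j) by apply: ideal_gen_mem.
have Jmax m : m \in ms -> J ('X_m ^+ k - 1).
  move=> m_ms; have := newton_nu_basis (f := idfun) 'X_m idJ Jg.
  rewrite map_id big_map (big_rem m) //= subrr mul0r subr0; exact.
have [/Jmax // | i_ms] := boolP (i \in ms).
rewrite -(subrK ('X_(max_class nu i) ^+ k) ('X_i ^+ k)) -addrA.
apply: idealD => //; last exact/Jmax/max_class_mem.
rewrite subrXX mulrC; apply: idealM => //.
by rewrite -nu_basis_nonmax.
Qed.

(** If the [nu]-basis vanishes at [mu], then [mu] is constant on the classes of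
[nu], and Newton's formula reads [T^k - 1 = \prod_m (T - r (mu m))] over the
class maxima [m]: at [T = r c], some [m] has color [c]. *)
Lemma meval_nu_basis_eq0 mu :
  (forall i, (g i).@[pt mu] = 0) <-> mu \in recolorings nu.
Proof.
split=> [g0 | /recoloringsP[s def_mu] i].
  have mu_max i : mu i = mu (max_class nu i).
    have [|i_ms] := boolP (i \in ms); first by rewrite mem_class_maxs => /eqP <-.
    have := g0 i; rewrite nu_basis_nonmax // mevalB !mevalXU => /eqP.
    by rewrite subr_eq0 => /eqP/r_inj.
  apply: recoloring_of_surj => // [i j /eq_max_class eq_ij | c].
    by rewrite mu_max eq_ij -mu_max.
  have := newton_nu_basis (r c) (is_ideal_zero K) g0.
  rewrite (root_expr r_split) subrr sub0r => /eqP; rewrite oppr_eq0 !big_map.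
  rewrite prodf_seq_eq0 => /hasP[m _ /=]; rewrite mevalXU subr_eq0.
  by rewrite (inj_eq r_inj) => /eqP ->; apply: codom_f.
have [i_ms | i_ms] := boolP (i \in ms); last first.
  rewrite nu_basis_nonmax // mevalB !mevalXU /color_point !def_mu.
  by rewrite nu_max_class subrr.
rewrite nu_basis_max // -map_drop [LHS]rmorph_newton_coef -map_comp.
apply: newton_coef_roots_eq0.
- rewrite map_inj_in_uniq ?drop_uniq ?uniq_class_maxs // => u v /mem_drop u_ms.
  move=> /mem_drop v_ms; rewrite /= !mevalXU => /r_inj; rewrite !def_mu.
  by move/perm_inj; apply: nu_inj_class_maxs.
- by rewrite size_map size_drop size_class_maxs // leq_subr.
by move=> _ /mapP[v _ ->]; rewrite /= mevalXU root_pt.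
Qed.

Lemma cut_out_nu_basis : cut_out r (ideal_gen xpredT g) (recolorings nu).
Proof.
apply: (cut_outP r_inj k_gt0 r_split).
- exact: is_ideal_gen.
- exact: ideal_nu_basis_nk.
- move=> mu p /meval_nu_basis_eq0 g0; exact: meval_ideal_gen_eq0.
move=> mu mu_nu.
have /existsP[i gi_neq0] : [exists i, (g i).@[pt mu] != 0].
  rewrite -negb_forall; apply: contraNN mu_nu => /forallP g0.
  by apply/meval_nu_basis_eq0 => i; apply/eqP.
by exists (g i); first exact: ideal_gen_mem.
Qed.

End NuBasis.
End GraphIdealTheory.

Theorem theorem1p9 (K : closedFieldType) (n k : nat)
  (k_gt0 : (0 < k)%N) (k_lt_n : (k < n)%N)
  (char_k : forall p, p \in [pchar K] -> ~~ (p %| k)%N)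
  (e : rel 'I_n) (e_sym : ssrbool.symmetric e) (e_irr : irreflexive e)
  (C : finType) (card_C : #|C| = k)
  (nu : {ffun 'I_n -> C}) (nu_proper : proper_coloring e nu)
  (nu_surj : forall c : C, c \in codom nu) :
  let g : 'I_n -> {mpoly K[n]} := nu_basis K k nu in
  let Ig : {mpoly K[n]} -> Prop := ideal_gen xpredT g in
  let IGk : {mpoly K[n]} -> Prop := ideal_Gk e k in
  [<-> uniquely_colorable C e;
       forall p, Ig p <-> IGk p;
       forall i, IGk (g i);
       ideal_colon (ideal_nk k) Ig (graph_poly K e);
       quotient_dim IGk k`!].
Proof.
move=> g Ig IGk.
have C_neq0 : #|C|%:R != 0 :> K.
  rewrite card_C natf_neq0_pchar; apply/pnatP => // p _ p_dv_k.
  by apply/negP => /char_k; rewrite p_dv_k.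
rewrite {}/IGk {}/Ig {}/g; subst k.
have [r r_inj r_split] := exists_root_labelling C_neq0.
have cut_n := @cut_out_ideal_nk K n C r r_inj C_neq0 r_split.
have cut_e := cut_out_ideal_Gk r_inj C_neq0 r_split e.
have cut_nu := cut_out_nu_basis r_inj C_neq0 r_split nu_surj.
have sub_nu := recolorings_proper nu_proper.
(* The recolorings are proper and there are k! of them, so a bound of k! on the
   number of proper colorings leaves room for no other. *)
have eq_cards : (#|proper_colorings C e| <= #|C|`!)%N ->
    proper_colorings C e = recolorings nu.
  move=> le_card; apply/esym/eqP; rewrite eqEcard sub_nu.
  by rewrite card_recolorings.
have unique := uniquely_colorableP nu_proper.
tfae.
- move/unique => eq_col p; apply: (iff_trans (cut_nu p)).
  by rewrite -eq_col; apply: iff_sym.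
- by move=> eq_I i; apply/eq_I; apply: ideal_gen_mem.
- move=> Ig p Ip; apply/cut_n => mu _; rewrite mevalM.
  have [mu_e | ] := boolP (mu \in proper_colorings C e); last first.
    by rewrite -(meval_graph_poly r_inj e_sym e_irr) negbK => /eqP ->; rewrite mul0r.
  rewrite (proj1 (cut_e p)) ?mulr0 //.
  by apply: ideal_gen_min Ip => //; apply: is_ideal_Gk.
- move=> colon; rewrite -(card_recolorings nu_surj).
  suff -> : recolorings nu = proper_colorings C e.
    exact: (quotient_dim_cut_out r_inj cut_e).
  apply/eqP; rewrite eqEsubset sub_nu; apply/subsetP => mu mu_e.
  apply/(meval_nu_basis_eq0 r_inj C_neq0 r_split nu_surj) => i.
  have /colon/cut_n/(_ mu (in_setT _))/eqP :=
    ideal_gen_mem (nu_basis K #|C| nu) (t := i) isT.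
  rewrite mevalM mulf_eq0 -[_ == 0]negbK (meval_graph_poly r_inj e_sym e_irr) mu_e.
  by move/eqP.
by move/(leq_quotient_dim r_inj cut_e)/eq_cards/unique.
Qed.
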